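(* For every integer $n\ge 0$, the number $N_{CSSG}(G_n)$ of connected spanning subgraphs of the Farey graph $G_n$ is $$N_{CSSG}(G_n)=2^{2^n-1}(n+1)\prod_{i=2}^{n} i^{2^{n-i}},$$ where an empty product equals $1$.
   Context: The Farey graphs $G_n$ ($n\ge 0$), each with two distinguished (''special'') vertices $X_n,Y_n$, are defined recursively. $G_0$ is a single edge joining its two special vertices $X_0$ and $Y_0$. For $n\ge 1$, take two disjoint copies $G_{n-1}^1,G_{n-1}^2$ of $G_{n-1}$, with special vertices $X_{n-1}^i,Y_{n-1}^i$ ($i=1,2$); identify $Y_{n-1}^1$ with $X_{n-1}^2$ into one vertex, and add a new edge $e_n$ joining $X_{n-1}^1$ and $Y_{n-1}^2$. The result is $G_n$, with special vertices $X_n=X_{n-1}^1$ and $Y_n=Y_{n-1}^2$. It has $2^n+1$ vertices and $2^{n+1}-1$ edges. A connected spanning subgraph of a graph $G$ is a connected subgraph $H$ with $V(H)=V(G)$ and $E(H)\subseteq E(G)$; subgraphs are counted as distinct when their edge sets differ. *)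

(* Defs.v *)
From mathcomp Require Import all_boot.

Set Implicit Arguments.
Unset Strict Implicit.
Unset Printing Implicit Defensive.

(* A finite simple graph (an edge is the set of its two ends) with two special
   vertices.  That edges have two elements is not part of the record; it is
   proved for the Farey graphs in [farey_edge_card]. *)
Record graph2 := Graph2 {
  vert : finType;
  edges : {set {set vert}};
  spX : vert;
  spY : vert
}.

Section Step.
Variable G : graph2.

(* Two disjoint copies of [G] in which the vertex Y of the first is identified
   with the vertex X of the second: the common vertex is represented by
   [inl (spY G)], so that the right summand omits X. *)
Definition glued_vert : finType := (vert G + {v : vert G | v != spX G})%type.

Definition copy1 (v : vert G) : glued_vert := inl v.

Definition copy2 (v : vert G) : glued_vert :=
  if insub v is Some u then inr u else inl (spY G).

Definition copy1_edges : {set {set glued_vert}} :=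
  [set copy1 @: (e : {set vert G}) | e in edges G].

Definition copy2_edges : {set {set glued_vert}} :=
  [set copy2 @: (e : {set vert G}) | e in edges G].

Definition new_edge : {set glued_vert} := [set copy1 (spX G); copy2 (spY G)].

Definition farey_step : graph2 :=
  @Graph2 glued_vert (new_edge |: (copy1_edges :|: copy2_edges))
    (copy1 (spX G)) (copy2 (spY G)).

End Step.

Definition edge_graph : graph2 :=
  @Graph2 bool [set [set false; true]] false true.

Fixpoint farey (n : nat) : graph2 :=
  if n is m.+1 then farey_step (farey m) else edge_graph.

Section SpanningSubgraphs.
Variable G : graph2.

(* A spanning subgraph of [G] is given by its edge set [A]. *)
Definition adj (A : {set {set vert G}}) : rel (vert G) :=
  fun x y => [set x; y] \in A.

Definition spanning_connected (A : {set {set vert G}}) : bool :=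
  [forall x, forall y, connect (adj A) x y].

Definition N_CSSG : nat :=
  #|[set A : {set {set vert G}} | (A \subset edges G) && spanning_connected A]|.

End SpanningSubgraphs.

Lemma copy1_inj G : injective (@copy1 G).
Proof. by move=> x y []. Qed.

Lemma copy2_inj G : injective (@copy2 G).
Proof.
move=> x y; rewrite /copy2.
case: insubP => [u _ <-|]; case: insubP => [v _ <-|] //=.
  by move=> [->].
by rewrite !negbK => /eqP -> /eqP ->.
Qed.

Lemma copy12 G x y : copy1 x = copy2 y -> x = spY G /\ y = spX G.
Proof.
rewrite /copy2; case: insubP => [//|].
by rewrite negbK => /eqP -> [->].
Qed.

Lemma farey_spXY n : spX (farey n) != spY (farey n).
Proof.
case: n => [|n] //=; apply/eqP => /copy12 [_ H].
by elim: n H => [|n IH] //= /esym /copy12 [_ /IH].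
Qed.

Lemma farey_edge_card n (e : {set vert (farey n)}) :
  e \in edges (farey n) -> #|e| = 2.
Proof.
elim: n e => [|n IH] e /=.
  by rewrite inE => /eqP ->; rewrite cards2.
rewrite !inE => /or3P[/eqP ->|/imsetP[f /IH <- ->]|/imsetP[f /IH <- ->]].
- by rewrite cards2 (farey_spXY n.+1).
- exact/card_imset/copy1_inj.
- exact/card_imset/copy2_inj.
Qed.

Lemma farey_vert_card n : #|vert (farey n)| = 2 ^ n + 1.
Proof.
elim: n => [|n IH] /=; first by rewrite card_bool.
have cX : #|[pred v | v != spX (farey n)]| = 2 ^ n.
  by rewrite (eq_card (B := predC1 (spX (farey n)))) // cardC1 IH addn1.
by rewrite card_sum card_sig cX IH expnS mul2n -addnn addnAC.
Qed.

(* In particular the images of the edges of the two copies and the new edge are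
   pairwise distinct. *)
Lemma farey_edges_card n : #|edges (farey n)| = 2 ^ n.+1 - 1.
Proof.
elim: n => [|n IH] /=; first by rewrite cards1.
have new1 : new_edge (farey n) \notin copy1_edges (farey n).
  apply/imsetP => -[f _ /setP /(_ (copy2 (spY (farey n))))].
  rewrite !inE eqxx orbT => /esym /imsetP[x _ /esym /copy12 [_ /esym]].
  by apply/eqP/farey_spXY.
have new2 : new_edge (farey n) \notin copy2_edges (farey n).
  apply/imsetP => -[f _ /setP /(_ (copy1 (spX (farey n))))].
  rewrite !inE eqxx => /esym /imsetP[x _ /copy12 [H _]].
  by move/eqP: H; apply/negP/farey_spXY.
have dis : copy1_edges (farey n) :&: copy2_edges (farey n) = set0.
  apply/setP => e; rewrite !inE; apply/negP => /andP[].
  case/imsetP => f fE -> /imsetP[g gE] /setP fg.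
  have: f \subset [set spY (farey n)].
    apply/subsetP => x xf; rewrite inE.
    have := fg (copy1 x); rewrite imset_f // => /esym /imsetP[y _].
    by case/copy12 => ->.
  by move/subset_leq_card; rewrite cards1 (farey_edge_card fE).
rewrite cardsU1 !inE negb_or new1 new2 cardsU dis cards0 subn0.
rewrite !card_imset ?IH; last 2 first.
- exact/imset_inj/copy2_inj.
- exact/imset_inj/copy1_inj.
rewrite [2 ^ n.+2]expnS mul2n -addnn.
by case: (2 ^ n.+1) (expn_gt0 2 n.+1) => // k _; rewrite /= !subn1 /= addnS.
Qed.

(* Main.v *)
Require Import Defs.
From mathcomp Require Import all_boot.
From mathcomp Require Import zify.

(** Call [A] bridged if it becomes connected once the edge [XY] is added, and
    split if it is bridged but not connected, i.e. has exactly two components,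
    one containing [X] and the other [Y].  Let [c] and [s] count the connected
    and the split edge sets of [G_n], and [c'] and [s'] those of [G_(n+1)].
    Without the new edge, an edge set of [G_(n+1)] is connected iff both halves
    are, and split iff one half is connected and the other split; with the new
    edge, it is connected exactly in these cases, and it is never split.  So
    [c' = 2 c ^ 2 + 2 c s] and [s' = 2 c s], whence [c = (n + 1) s] by induction
    and [s' = 2 (n + 1) s ^ 2].

    Connectivity is handled through two-colourings that are constant along
    edges: such a colouring of a glued graph is a pair of colourings of the
    halves that agree at the common vertex. *)

Set Implicit Arguments.
Unset Strict Implicit.
Unset Printing Implicit Defensive.

(** * Sums over all subsets of an image or of a union *)

Lemma powerset_imset (T U : finType) (h : T -> U) (E : {set T}) :
  powerset (h @: E) = (fun A : {set T} => h @: A) @: powerset E.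
Proof.
apply/setP => B; apply/idP/imsetP => [|[A]]; last first.
  by rewrite !inE => AE ->; apply: imsetS.
rewrite inE => /subsetP BE; exists (E :&: h @^-1: B); first by rewrite inE subsetIl.
apply/setP => y; apply/idP/imsetP => [yB|[x]]; last by rewrite !inE => /andP[_ xB] ->.
by have /imsetP[x xE y_hx] := BE _ yB; exists x; rewrite // !inE xE -y_hx.
Qed.

Lemma sum_powerset_imset (T U : finType) (h : T -> U) (E : {set T})
    (g : {set U} -> nat) : injective h ->
  \sum_(B in powerset (h @: E)) g B = \sum_(A in powerset E) g (h @: A).
Proof.
by move=> h_inj; rewrite powerset_imset big_imset // => A B _ _; apply: imset_inj.
Qed.

(** A subset of the union is determined by its traces on [E] and [F]; disjointness makes every pair
    of traces arise from exactly one subset. *)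
Lemma sum_powersetU (T : finType) (E F : {set T}) (g : {set T} -> nat) :
  [disjoint E & F] ->
  \sum_(A in powerset (E :|: F)) g A =
  \sum_(A in powerset E) \sum_(B in powerset F) g (A :|: B).
Proof.
move=> dEF; rewrite pair_big /=.
have dFE : F :&: E = set0 by apply/disjoint_setI0; rewrite disjoint_sym.
rewrite (reindex_onto (fun p : {set T} * {set T} => p.1 :|: p.2)
                      (fun A => (A :&: E, A :&: F))) /=; last first.
  by move=> A; rewrite inE -setIUr => /setIidPl.
apply: eq_bigl => -[A B] /=; rewrite !inE; apply/andP/andP => [[_]|[AE BF]].
  by case/eqP=> <- <-; rewrite !subsetIr.
split; first exact: setUSS.
rewrite !setIUl (setIidPl AE) (setIidPl BF).
have /eqP -> : B :&: E == set0 by rewrite -subset0 -dFE setSI.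
have /eqP -> : A :&: F == set0 by rewrite -subset0 -dFE setIC setIS.
by rewrite setU0 set0U.
Qed.

Lemma sum_powersetU1 (T : finType) (x : T) (E : {set T}) (g : {set T} -> nat) :
  x \notin E ->
  \sum_(A in powerset (x |: E)) g A =
  \sum_(A in powerset E) g A + \sum_(A in powerset E) g (x |: A).
Proof.
move=> xE; rewrite sum_powersetU ?disjoints1 // powerset1.
rewrite big_setU1 ?big_set1 /=; last first.
  by rewrite inE eq_sym -cards_eq0 cards1.
by congr (_ + _); apply: eq_bigr => A _; rewrite set0U.
Qed.

(** * Connectivity through two-colourings *)

Section Colourings.
Variable G : graph2.
Implicit Types (A : {set {set vert G}}) (f : vert G -> bool).

Definition colouring A f := forall x y, [set x; y] \in A -> f x = f y.

Lemma connect_colouring A x y :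
  reflect (forall f, colouring A f -> f x = f y) (connect (adj A) x y).
Proof.
apply: (iffP idP) => [/connectP[p] + -> f fA|fE].
  by elim: p x => //= z p IH x /andP[/fA -> /IH].
(* The indicator of the component of [x] is itself a colouring. *)
rewrite -(fE (connect (adj A) x)) ?connect0 // => u v uvA.
apply/idP/idP => xu; apply: connect_trans xu (connect1 _) => //.
by rewrite /adj setUC.
Qed.

Lemma spanning_connectedP A :
  reflect (forall f, colouring A f -> forall x y, f x = f y)
          (spanning_connected A).
Proof.
apply: (iffP forallP) => [cA f fA x y|cA x].
  by have /forallP/(_ y)/connect_colouring := cA x; apply.
by apply/forallP => y; apply/connect_colouring => f fA; apply: cA.
Qed.

Definition spanning_bridged A := spanning_connected ([set spX G; spY G] |: A).

Lemma spanning_bridgedP A :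
  reflect (forall f, colouring A f -> f (spX G) = f (spY G) ->
             forall x y, f x = f y)
          (spanning_bridged A).
Proof.
apply: (iffP (spanning_connectedP _)) => H f fA => [fXY|]; last first.
  apply: H; first by move=> x y xyA; apply: fA; rewrite inE xyA orbT.
  by apply: fA; rewrite setU11.
apply: H => x y; rewrite in_setU1 => /orP[/eqP xyE|/fA //].
have: x \in [set spX G; spY G] by rewrite -xyE set21.
have: y \in [set spX G; spY G] by rewrite -xyE set22.
by rewrite !inE => /orP[] /eqP -> /orP[] /eqP ->.
Qed.

Definition spanning_split A := spanning_bridged A && ~~ spanning_connected A.

Definition joined A := connect (adj A) (spX G) (spY G).

Lemma spanning_connectedE A :
  spanning_connected A = spanning_bridged A && joined A.
Proof.
apply/spanning_connectedP/andP => [cA|[/spanning_bridgedP bA /connect_colouring jA]].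
  split; last by apply/connect_colouring => f /cA.
  by apply/spanning_bridgedP => f /cA.
by move=> f fA; apply: bA (jA _ fA).
Qed.

Lemma spanning_splitE A :
  spanning_split A = spanning_bridged A && ~~ joined A.
Proof. by rewrite /spanning_split spanning_connectedE; case: spanning_bridged. Qed.

(** Counting as a sum of truth values lets the identities for single edge sets be summed
    directly. *)
Definition N_split := \sum_(A in powerset (edges G)) spanning_split A.

Lemma N_CSSGE : N_CSSG G = \sum_(A in powerset (edges G)) spanning_connected A.
Proof.
rewrite /N_CSSG -sum1_card -big_mkcondr /=.
by apply: eq_bigl => A; rewrite !inE.
Qed.

End Colourings.

(** * Edge sets of the glued graph *)

Section Step.
Variable G : graph2.
Let H := farey_step G.
Implicit Types A B : {set {set vert G}}.

Definition glue A B : {set {set vert H}} :=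
  [set @copy1 G @: (e : {set vert G}) | e in A] :|:
  [set @copy2 G @: (e : {set vert G}) | e in B].

Lemma glued_vertP (v : vert H) :
  (exists x, v = copy1 x) \/ (exists x, v = copy2 x).
Proof.
case: v => [x|u]; [by left; exists x | right; exists (val u)].
by rewrite /copy2 valK.
Qed.

Lemma imset_edgeP (U : finType) (h : vert G -> U) A x y :
  injective h -> [set x; y] \in [set h @: (e : {set vert G}) | e in A] ->
  exists x' y', [/\ x = h x', y = h y' & [set x'; y'] \in A].
Proof.
move=> h_inj /imsetP[e eA xyE].
have /imsetP[x' _ xE] : x \in h @: e by rewrite -xyE set21.
have /imsetP[y' _ yE] : y \in h @: e by rewrite -xyE set22.
exists x', y'; split => //; suff -> : [set x'; y'] = e by [].
by apply: (imset_inj h_inj); rewrite -xyE xE yE imsetU !imset_set1.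
Qed.

Lemma colouring_glueP A B (f : vert H -> bool) :
  colouring (glue A B) f <->
  colouring A (f \o @copy1 G) /\ colouring B (f \o @copy2 G).
Proof.
split => [fAB|[fA fB] x y].
  by split=> x y xyE; apply: fAB; rewrite inE; apply/orP; [left|right];
     apply/imsetP; exists [set x; y]; rewrite // imsetU !imset_set1.
rewrite inE => /orP[|] /imset_edgeP.
  by case/(_ (@copy1_inj G)) => [x' [y' [-> -> /fA]]].
by case/(_ (@copy2_inj G)) => [x' [y' [-> -> /fB]]].
Qed.

Lemma copy2_spX : copy2 (spX G) = copy1 (spY G).
Proof. by rewrite /copy2 insubF ?eqxx. Qed.

Lemma glue_colouring A B (f g : vert G -> bool) :
  colouring A f -> colouring B g -> f (spY G) = g (spX G) ->
  exists k : vert H -> bool,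
    [/\ colouring (glue A B) k, forall x, k (copy1 x) = f x
      & forall x, k (copy2 x) = g x].
Proof.
move=> fA gB fg.
pose k (v : vert H) := match v with inl x => f x | inr u => g (val u) end.
(* Agreement of [f] and [g] matters only at [spX G], which [copy2] sends into the first summand. *)
have k2 x : k (copy2 x) = g x.
  rewrite /copy2; case: insubP => [u _ <-|] //=.
  by rewrite negbK => /eqP ->.
exists k; split => //; apply/colouring_glueP; split => x y /=; first exact: fA.
by rewrite !k2; apply: gB.
Qed.

Lemma joined_glue A B : joined (glue A B) = joined A && joined B.
Proof.
apply/connect_colouring/andP => [jAB|[/connect_colouring jA /connect_colouring jB]].
  split; apply/connect_colouring => f fE.
    (* A colouring of one half extends to the glued graph by a constant on the other half. *)
    have [|k [kAB k1 k2]] := @glue_colouring A B f (fun=> f (spY G)) fE _ erefl.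
      by move=> x y.
    by have := jAB _ kAB; rewrite /= k1 k2.
  have [|k [kAB k1 k2]] := @glue_colouring A B (fun=> f (spX G)) f _ fE erefl.
    by move=> x y.
  by have := jAB _ kAB; rewrite /= k1 k2.
move=> f /colouring_glueP[/jA /= -> /jB /= <-].
by rewrite copy2_spX.
Qed.

Lemma constant_glue (f : vert H -> bool) :
  (forall x y, f (copy1 x) = f (copy1 y)) ->
  (forall x y, f (copy2 x) = f (copy2 y)) -> forall x y, f x = f y.
Proof.
move=> f1 f2; suff fE v : f v = f (copy1 (spY G)) by move=> x y; rewrite !fE.
case: (glued_vertP v) => [[x ->]|[x ->]]; first exact: f1.
by rewrite -copy2_spX; apply: f2.
Qed.

(** The edge between the special vertices closes the two halves into a ring, which may be broken in
    at most one half: otherwise the common vertex is cut off from both special vertices. *)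
Lemma bridged_glue A B :
  spanning_bridged (glue A B) =
  [&& spanning_bridged A, spanning_bridged B & joined A || joined B].
Proof.
apply/spanning_bridgedP/and3P => [bAB|[/spanning_bridgedP bA /spanning_bridgedP bB jAB]].
  split.
  - apply/spanning_bridgedP => f fA fXY x y.
    have [|k [kAB k1 k2]] := @glue_colouring A B f (fun=> f (spY G)) fA _ erefl.
      by move=> u v.
    by rewrite -!k1; apply: bAB; rewrite //= k1 k2.
  - apply/spanning_bridgedP => f fB fXY x y.
    have [|k [kAB k1 k2]] := @glue_colouring A B (fun=> f (spX G)) f _ fB erefl.
      by move=> u v.
    by rewrite -!k2; apply: bAB; rewrite //= k1 k2.
  - apply/negPn/negP; rewrite negb_or => /andP[/connect_colouring jA /connect_colouring jB].
    apply: jA => f fA; apply/eqP/negPn/negP => fXY.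
    apply: jB => g gB; apply/eqP/negPn/negP => gXY.
    (* Composing [g] with a swap of the colours makes it match [f] at the common
       vertex; having only two colours, [f X] and [g Y] then coincide. *)
    pose g' x := g x (+) (g (spX G) (+) f (spY G)).
    have g'B : colouring B g' by move=> x y /gB; rewrite /g' => ->.
    have [|k [kAB k1 k2]] := @glue_colouring A B f g' fA g'B.
      by rewrite /g' addbA addbb.
    move/negP: (fXY); apply; apply/eqP; rewrite -!k1; apply: bAB => //=; rewrite k1 k2 /g'.
    by move: fXY gXY; do 2!case: (f _); do 2!case: (g _).
move=> f /colouring_glueP[fA fB] /= fXY.
have fM : f (copy1 (spX G)) = f (copy1 (spY G)).
  case/orP: jAB => /connect_colouring; first by move/(_ _ fA).
  by move/(_ _ fB); rewrite /= copy2_spX -fXY.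
apply: constant_glue => x y; first exact: (bA _ fA).
by apply: (bB _ fB); rewrite /= copy2_spX -fM.
Qed.

Lemma connected_glue A B :
  spanning_connected (glue A B) = spanning_connected A && spanning_connected B.
Proof.
rewrite !spanning_connectedE bridged_glue joined_glue.
by case: (spanning_bridged A) (spanning_bridged B) (joined A) (joined B) => [] [] [] [].
Qed.

(** The two cases exclude each other, so their disjunction is a sum in [nat]. *)
Lemma split_glue A B :
  spanning_split (glue A B) =
    (spanning_split A && spanning_connected B) +
    (spanning_connected A && spanning_split B) :> nat.
Proof.
rewrite !spanning_splitE !spanning_connectedE bridged_glue joined_glue.
by case: (spanning_bridged A) (spanning_bridged B) (joined A) (joined B) => [] [] [] [].
Qed.

(** The new edge is by definition the one that [spanning_bridged] adds to an edge set of [H], and a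
    bridged set is either connected or split, never both. *)
Lemma connected_new_edge (A : {set {set vert H}}) :
  spanning_connected (new_edge G |: A : {set {set vert H}}) =
  spanning_connected A + spanning_split A :> nat.
Proof.
rewrite -/(spanning_bridged A) spanning_splitE spanning_connectedE.
by case: spanning_bridged => //; case: joined.
Qed.

(** Adding the edge a second time changes nothing, so bridged already means connected here. *)
Lemma split_new_edge (A : {set {set vert H}}) :
  spanning_split (new_edge G |: A : {set {set vert H}}) = false.
Proof.
by rewrite /spanning_split /spanning_bridged setUA setUid andbN.
Qed.

(** * Recursion for the two counts *)

Hypothesis edgesH : #|edges H| = (#|edges G|).*2.+1.

Lemma card_copies :
  #|copy1_edges G| = #|edges G| /\ #|copy2_edges G| = #|edges G|.
Proof.
split; apply: card_imset; apply: imset_inj; [exact: copy1_inj | exact: copy2_inj].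
Qed.

(** The copies and the new edge contribute at most [2 * #|edges G| + 1] edges; [edgesH] says that
    this bound is attained, so nothing coincides. *)
Lemma new_edge_fresh_disjoint_copies :
  new_edge G \notin copy1_edges G :|: copy2_edges G /\
  [disjoint copy1_edges G & copy2_edges G].
Proof.
rewrite -setI_eq0 -cards_eq0.
have := cardsUI (copy1_edges G) (copy2_edges G).
have := edgesH; rewrite /= cardsU1; have [-> ->] := card_copies.
by case: (_ \notin _); move: #|_ :|: _| #|_ :&: _| #|edges G| => x y z /=; lia.
Qed.

Let new_edge_fresh := proj1 new_edge_fresh_disjoint_copies.
Let disjoint_copies := proj2 new_edge_fresh_disjoint_copies.

Lemma sum_glue (g : {set {set vert H}} -> nat) :
  \sum_(A in powerset (copy1_edges G :|: copy2_edges G)) g A =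
  \sum_(A in powerset (edges G)) \sum_(B in powerset (edges G)) g (glue A B).
Proof.
rewrite sum_powersetU ?disjoint_copies // sum_powerset_imset; last first.
  exact/imset_inj/copy1_inj.
apply: eq_bigr => A _; rewrite sum_powerset_imset //.
exact/imset_inj/copy2_inj.
Qed.

Lemma sum_glue_connected :
  \sum_(A in powerset (copy1_edges G :|: copy2_edges G))
     @spanning_connected H A = N_CSSG G * N_CSSG G.
Proof.
rewrite sum_glue !N_CSSGE big_distrlr /=.
by apply: eq_bigr => A _; apply: eq_bigr => B _; rewrite connected_glue mulnb.
Qed.

Lemma sum_glue_split :
  \sum_(A in powerset (copy1_edges G :|: copy2_edges G))
     @spanning_split H A = 2 * (N_CSSG G * N_split G).
Proof.
rewrite sum_glue mul2n -addnn {1}[N_CSSG G * _]mulnC !N_CSSGE !big_distrlr /=.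
rewrite -big_split; apply: eq_bigr => A _; rewrite -big_split.
by apply: eq_bigr => B _; rewrite split_glue !mulnb.
Qed.

Lemma N_split_step : N_split H = 2 * (N_CSSG G * N_split G).
Proof.
rewrite /N_split sum_powersetU1 ?new_edge_fresh // sum_glue_split.
by rewrite [X in _ + X]big1 ?addn0 // => A _; rewrite split_new_edge.
Qed.

Lemma N_CSSG_step : N_CSSG H = 2 * (N_CSSG G * (N_CSSG G + N_split G)).
Proof.
rewrite N_CSSGE sum_powersetU1 ?new_edge_fresh //.
under [X in _ + X]eq_bigr do rewrite connected_new_edge.
rewrite big_split sum_glue_connected sum_glue_split /=; lia.
Qed.

End Step.

(** * Solving the recursion for the Farey graphs *)

Lemma farey_edges_step n :
  #|edges (farey n.+1)| = (#|edges (farey n)|).*2.+1.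
Proof. by rewrite !farey_edges_card [2 ^ n.+2]expnS; have := expn_gt0 2 n.+1; lia. Qed.

Lemma edge_graph_counts : N_CSSG edge_graph = 1 /\ N_split edge_graph = 1.
Proof.
have c0 : spanning_connected (set0 : {set {set vert edge_graph}}) = false.
  (* Without edges, the identity of [bool] is a non-constant colouring. *)
  apply/negP => /spanning_connectedP/(_ id) c0.
  by suff /c0/(_ true false) : @colouring edge_graph set0 id by []; move=> x y; rewrite inE.
have c1 : spanning_connected ([set [set false; true]] : {set {set vert edge_graph}}).
  apply/spanning_connectedP => f fE.
  by have {}fE : f false = f true by [apply: fE; rewrite inE]; case=> -[].
have set0N1 : set0 \notin [set [set [set false; true]]].
  by rewrite inE eq_sym -cards_eq0 cards1.
rewrite N_CSSGE /N_split powerset1 !big_setU1 ?big_set1 //=.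
rewrite /spanning_split /spanning_bridged /= setU0 setUid.
by rewrite c0 c1.
Qed.

Lemma N_CSSG_farey_split n : N_CSSG (farey n) = n.+1 * N_split (farey n).
Proof.
elim: n => [|n IH]; first by have [-> ->] := edge_graph_counts.
rewrite (N_CSSG_step (farey_edges_step n)) (N_split_step (farey_edges_step n)) IH.
by move: (N_split _) => s; nia.
Qed.

Lemma N_split_farey n :
  N_split (farey n) =
  2 ^ (2 ^ n - 1) * \prod_(2 <= i < n.+1) i ^ (2 ^ (n - i)).
Proof.
elim: n => [|n IH].
  by have [_ ->] := edge_graph_counts; rewrite big_geq.
rewrite (N_split_step (farey_edges_step n)) N_CSSG_farey_split IH.
(* Passing from [n] to [n.+1] doubles each exponent [2 ^ (n - i)] and adds the factor [i = n.+1]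
   with exponent 1. For [n = 0] both products are empty and the added factor is 1. *)
have -> : \prod_(2 <= i < n.+2) i ^ (2 ^ (n.+1 - i)) =
    n.+1 * (\prod_(2 <= i < n.+1) i ^ (2 ^ (n - i))) ^ 2.
  case: n {IH} => [|n]; first by rewrite !big_geq.
  rewrite big_nat_recr //= subnn mulnC; congr (_ * _).
  rewrite -mulnn -big_split [LHS]big_nat [RHS]big_nat.
  by apply: eq_bigr => i /andP[_ i_le]; rewrite subSn // expnSr expnM -mulnn.
have -> : 2 ^ n.+1 - 1 = (2 ^ n - 1) * 2 + 1.
  by rewrite expnS; have := expn_gt0 2 n; lia.
rewrite expnD expnM -!mulnn.
by move: (2 ^ _) (\prod_(_ <- _) _) => a p; nia.
Qed.

Theorem mainTheorem4 (n : nat) :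
  N_CSSG (farey n) =
  2 ^ (2 ^ n - 1) * (n + 1) * \prod_(2 <= i < n.+1) i ^ (2 ^ (n - i)).
Proof.
by rewrite N_CSSG_farey_split N_split_farey addn1 mulnA [n.+1 * _]mulnC.
Qed.
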